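(* Let $0<\varepsilon<1$ and let $n(m):=n_\varepsilon(m)$ for $m\ge0$. Then, for every $m\ge1$ and any $\tau\in[0,1]$, the total cost $C_m$ after $m$ steps of the sequential sampling algorithm (described in the context, run with these sample sizes) satisfies $$\Pr\bigl(C_m\geq n(m)+(1+\tau)(n(m-1)+1)\bigr)\;\leq\; M_\tau\, e^{-\frac{\tau^2}{6}n(m-1)}\;\leq\; M_\tau\left(\frac{2(m-1)}{\varepsilon}\right)^{-\frac{\tau^2c}{6}(m-1)},$$ where $M_\tau:=e^{\frac{2c\tau^2}{3}}$.
   Context: Constants and sample sizes. $c:=\frac{2}{1-\ln 2}$. For $0<\varepsilon<1$ and $m\ge1$, $n_\varepsilon(m):=\lceil c\,m\,(\ln(2m)-\ln\varepsilon)\rceil$, and $n_\varepsilon(0):=0$. For $m=1$ the last expression is read with the convention $0^0=1$. Spaces and measures. $D\subseteq\mathbb{R}^d$ is a domain, $\rho$ a probability measure on $D$, and $\varphi_1,\varphi_2,\dots$ is a given sequence of functions in $L^2(D,\rho)$ such that for each $m\geq1$, $\{\varphi_1,\dots,\varphi_m\}$ is an $L^2(D,\rho)$-orthonormal basis of a space $V_m$ (so $V_1\subset V_2\subset\cdots$). Put $d\sigma_j:=|\varphi_j|^2\,d\rho$ and $d\mu_m:=\frac1m\sum_{j=1}^m|\varphi_j|^2\,d\rho$, which are probability measures. Sequential sampling algorithm (Algorithm 1). Let $(n(m))_{m\ge1}$ be the increasing sequence of prescribed sample sizes. Start with $S_1=\{x_1^1,\dots,x_1^{n(1)}\}$ consisting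 of $n(1)$ i.i.d. draws from $\mu_1$. Given $S_m=\{x_m^1,\dots,x_m^{n(m)}\}$, produce $S_{m+1}=\{x_{m+1}^1,\dots,x_{m+1}^{n(m+1)}\}$ as follows, all new random draws being independent of each other and of everything drawn before. For $i=1,\dots,n(m)$: draw $a_i$ uniformly in $\{1,\dots,m+1\}$; if $a_i=m+1$, draw $x_{m+1}^i$ from $\sigma_{m+1}$; otherwise set $x_{m+1}^i:=x_m^i$. For $i=n(m)+1,\dots,n(m+1)$: draw $x_{m+1}^i$ from $\mu_{m+1}$ (by drawing $j$ uniformly in $\{1,\dots,m+1\}$ and then drawing from $\sigma_j$). Total cost. $C_m$ is the total number of sample points drawn (from $D$) in order to generate $S_1,\dots,S_m$. Explicitly, $C_m=n(m)+s(m)$ with $s(m)=\sum_{k=1}^{m-1}\sum_{i=1}^{n(k)}b^i_{k+1}$, where $b^i_{k+1}$ is the indicator of the event that $a_i=k+1$ in the step from $S_k$ to $S_{k+1}$; the $b^i_{k+1}$ are independent Bernoulli random variables with $\Pr(b^i_{k+1}=1)=\frac1{k+1}$. *)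

(* Defs.v *)
From HB Require Import structures.
From mathcomp Require Import all_boot all_order all_algebra finmap.
From mathcomp Require Import all_classical all_reals all_analysis.

Set Implicit Arguments.
Unset Strict Implicit.
Unset Printing Implicit Defensive.

Import Order.TTheory GRing.Theory Num.Theory.
Import numFieldNormedType.Exports.

Local Open Scope classical_set_scope.
Local Open Scope ring_scope.

Definition sampling_const (R : realType) : R := 2 / (1 - ln 2).

(* For 0 < eps < 1 and 0 < m the ceiling is nonnegative, so that taking its
   absolute value only serves to land in nat. *)
Definition sample_size (R : realType) (eps : R) (m : nat) : nat :=
  if m == 0%N then 0%N else
  `|Num.ceil (sampling_const R * m%:R * (ln (2 * m%:R) - ln eps))|%N.

Definition tail_const (R : realType) (tau : R) : R :=
  expR (2 * sampling_const R * tau ^+ 2 / 3).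

(* R^d with its Borel sigma-algebra. *)
Notation borel_rV R d := (g_sigma_algebraType (@open 'rV[R]_d)).

Definition is_domain (R : realType) (d : nat) (D : set 'rV[R]_d) : Prop :=
  [/\ open D, connected D & D !=set0].

Section Densities.
Context {R : realType} {d : nat}.
Variables (D : set (borel_rV R d)) (rho : probability (borel_rV R d) R).
Variable phi : nat -> borel_rV R d -> R.

(* The sequence is phi 1, phi 2, ...; the value phi 0 is never used. *)
Definition orthonormal_sequence : Prop :=
  [/\ forall j, (0 < j)%N -> measurable_fun D (phi j),
      forall j, (0 < j)%N ->
        rho.-integrable D (fun x => (`|phi j x| ^+ 2)%:E)
    & forall i j, (0 < i)%N -> (0 < j)%N ->
        (\int[rho]_(x in D) (phi i x * phi j x)%:E)%E = ((i == j)%:R)%:E].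

Definition sigma_law (j : nat) (B : set (borel_rV R d)) : \bar R :=
  (\int[rho]_(x in D `&` B) (`|phi j x| ^+ 2)%:E)%E.

Definition mu_law (m : nat) (B : set (borel_rV R d)) : \bar R :=
  ((m%:R^-1)%:E * \sum_(1 <= j < m.+1) sigma_law j B)%E.

End Densities.

(* Mutual independence of the classes of events F i, for i ranging over J. *)
Definition mutually_independent (R : realType) (dO : measure_display)
    (Omega : measurableType dO) (P : probability Omega R)
    (I : choiceType) (J : set I) (F : I -> set (set Omega)) : Prop :=
  forall (s : {fset I}) (E : I -> set Omega),
    (forall i, i \in s -> J i) ->
    (forall i, i \in s -> F i (E i)) ->
    P (\bigcap_(i in [set` s]) E i) = (\prod_(i <- s) P (E i))%E.

Section Algorithm.
Context {R : realType} {d : nat} {dO : measure_display}.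
Context {Omega : measurableType dO}.

(* Positions in a sample are numbered from 0, levels from 1; n 0 = 0 is
   assumed, so that all the points of S_1 are new.  The label a k i is the
   number drawn in {1, ..., k} for position i < n (k - 1) in the step from
   S_(k-1) to S_k.  The point x k i is the one drawn from D for position i of
   S_k whenever a draw takes place there; at a position where the point of
   S_(k-1) is kept, x k i is a fictitious variable which is neither used in the
   sample nor counted in the cost. *)

Definition drawn (n : nat -> nat) (a : nat -> nat -> Omega -> nat)
    (k i : nat) (w : Omega) : bool :=
  (n k.-1 <= i)%N || (a k i w == k).

Definition cost (n : nat -> nat) (a : nat -> nat -> Omega -> nat)
    (m : nat) (w : Omega) : nat :=
  (\sum_(1 <= k < m.+1) \sum_(0 <= i < n k) drawn n a k i w)%N.

(* inl (k, i) stands for the label a k i and inr (k, i) for the point x k i. *)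
Definition random_draws (n : nat -> nat) : set (nat * nat + nat * nat)%type :=
  fun v => match v with
           | inl (k, i) => (0 < k)%N && (i < n k.-1)%N
           | inr (k, i) => (0 < k)%N && (i < n k)%N
           end.

Definition draw_events (a : nat -> nat -> Omega -> nat)
    (x : nat -> nat -> Omega -> borel_rV R d) (v : nat * nat + nat * nat) :
    set (set Omega) :=
  match v with
  | inl (k, i) => preimage_set_system setT (a k i) measurable
  | inr (k, i) => preimage_set_system setT (x k i) measurable
  end.

(* S m i is the point at position i of S_m. *)
Record sequential_sampling (D : set (borel_rV R d))
    (rho : probability (borel_rV R d) R) (phi : nat -> borel_rV R d -> R)
    (n : nat -> nat) (P : probability Omega R)
    (a : nat -> nat -> Omega -> nat)
    (x S : nat -> nat -> Omega -> borel_rV R d) : Prop := {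
  label_measurable : forall k i, random_draws n (inl (k, i)) ->
    measurable_fun setT (a k i);
  label_uniform : forall k i, random_draws n (inl (k, i)) ->
    forall j, (1 <= j <= k)%N -> P (a k i @^-1` [set j]) = (k%:R^-1)%:E;
  point_measurable : forall k i, random_draws n (inr (k, i)) ->
    measurable_fun setT (x k i);
  point_law : forall k i, random_draws n (inr (k, i)) ->
    forall B, measurable B ->
      P (x k i @^-1` B) =
        if (i < n k.-1)%N then sigma_law D rho phi k B
        else mu_law D rho phi k B;
  draws_independent :
    mutually_independent P (random_draws n) (draw_events a x);
  sample_step : forall k i w, (i < n k.+1)%N ->
    S k.+1 i w = if drawn n a k.+1 i w then x k.+1 i w else S k i w
}.

Lemma cost_explicit (n : nat -> nat) (a : nat -> nat -> Omega -> nat)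
    (m : nat) (w : Omega) :
  n 0%N = 0%N -> (forall k, (n k <= n k.+1)%N) ->
  cost n a m w =
  (n m + \sum_(1 <= k < m) \sum_(0 <= i < n k) (a k.+1 i w == k.+1))%N.
Proof.
move=> n0 nS; rewrite /cost; elim: m => [|m IHm].
  by rewrite !big_geq// n0.
rewrite big_nat_recr//= {}IHm (big_cat_nat _ (nS m))//=.
have -> : (\sum_(n m <= i < n m.+1) drawn n a m.+1 i w = n m.+1 - n m)%N.
  rewrite -[RHS]muln1 -sum_nat_const_nat; apply: eq_big_nat => i /andP[+ _].
  by rewrite /drawn /= => ->.
have -> : (\sum_(0 <= i < n m) drawn n a m.+1 i w =
           \sum_(0 <= i < n m) (a m.+1 i w == m.+1))%N.
  apply: eq_big_nat => i /andP[_ im].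
  by rewrite /drawn /= leqNgt im.
case: m nS => [|m] nS; first by rewrite !n0 !big_geq// subn0 !addn0.
rewrite [in RHS]big_nat_recr//= [(_ + (n _ - _))%N]addnC addnACA.
by rewrite subnKC ?nS.
Qed.

End Algorithm.

(* Main.v *)
Require Import Defs.
From HB Require Import structures.
From mathcomp Require Import all_boot all_order all_algebra finmap.
From mathcomp Require Import all_classical all_reals all_analysis.
From mathcomp Require Import measurable_realfun ring lra.

Set Implicit Arguments.
Unset Strict Implicit.
Unset Printing Implicit Defensive.

Import Order.TTheory GRing.Theory Num.Theory.
Import numFieldNormedType.Exports.

Local Open Scope classical_set_scope.
Local Open Scope ring_scope.

(* Beyond n(m) points, the cost is a sum s of independent indicators, with
   E s = sum_(1 <= k < m) n(k) / (k + 1).  Since n(k) <= c k L_k + 1, where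
   L_k = ln (2k) - ln eps and c L_k >= 1, each term is at most c L_k
   <= c L_(m-1), so that E s <= n(m - 1).  Chernoff's bound is then applied
   with the exponential moment E (1 + tau)^s: writing (1 + tau)^s as the product
   of the factors 1 + tau 1_A, it is at most exp (tau E s). *)

(** * Elementary inequalities for the logarithm *)

Lemma ln_ge1BV (R : realType) (x : R) : 0 < x -> 1 - x^-1 <= ln x.
Proof.
move=> x0; have xV0 : 0 < x^-1 by rewrite invr_gt0.
have : ln (1 + (x^-1 - 1)) <= x^-1 - 1 by apply: le_ln1Dx; lra.
by rewrite addrCA subrr addr0 lnV ?posrE//; lra.
Qed.

(** Applied at [1 + x], [ln_ge1BV] yields only the linear term [x]. Applied at [s], the square root
    of [1 + x], it yields [2 * s * (s - 1)], which also has enough of the quadratic term. *)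
Lemma mul1Dx_ln1Dx_ge (R : realType) (x : R) :
  0 <= x <= 1 -> x + x ^+ 2 / 6 <= (1 + x) * ln (1 + x).
Proof.
move=> /andP[x0 x1].
have x1_gt0 : 0 < 1 + x by lra.
set s := Num.sqrt (1 + x).
have s0 : 0 < s by rewrite sqrtr_gt0.
have s2 : s ^+ 2 = 1 + x by rewrite sqr_sqrtr// ltW.
have xE : x = s ^+ 2 - 1 by rewrite s2; lra.
have s1 : 1 <= s by move: s2; rewrite expr2; nra.
(* With [x <= 1], this bound gives exactly [(s + 1) ^+ 2 = x + 2 + 2 * s <= 6], the sign condition
   in the factorization below. *)
have s32 : s <= 3 / 2 by move: s2; rewrite expr2; nra.
rewrite -s2 lnXn// xE -[ln s *+ 2]mulr_natl.
apply: (@le_trans _ _ (s ^+ 2 * (2 * (1 - s^-1)))); last first.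
  by rewrite ler_wpM2l ?sqr_ge0// ler_wpM2l// ln_ge1BV.
have -> : s ^+ 2 * (2 * (1 - s^-1)) = 2 * s * (s - 1) by field; rewrite gt_eqF.
rewrite -subr_ge0.
have -> : 2 * s * (s - 1) - (s ^+ 2 - 1 + (s ^+ 2 - 1) ^+ 2 / 6) =
   (s - 1) ^+ 2 * (6 - (s + 1) ^+ 2) / 6 by field.
have : (s + 1) ^+ 2 <= 6 by rewrite sqrrD s2; lra.
by move=> ?; rewrite divr_ge0// mulr_ge0 ?sqr_ge0//; lra.
Qed.

(** * Chernoff's bound for finitely many independent events *)

Section Chernoff.
Context {R : realType} {dO : measure_display} {Omega : measurableType dO}.
Variables (P : probability Omega R) (I : choiceType).
Variables (E : I -> set Omega) (p : I -> R) (J : {fset I}).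
Hypothesis mE : forall i, i \in J -> measurable (E i).
Hypothesis PE : forall i, i \in J -> P (E i) = (p i)%:E.
Hypothesis indepE : forall t : {fset I}, {subset t <= J} ->
  P (\bigcap_(i in [set` t]) E i) = (\prod_(i <- t) P (E i))%E.

Lemma measurable_prod1D_indic (tau : R) (D : set Omega) (s : seq I) :
  {subset s <= J} ->
  measurable_fun D
    (EFin \o (fun w => \prod_(i <- s) (1 + tau * \1_(E i) w) : R)).
Proof.
move=> sJ; apply/measurable_EFinP; apply: measurable_prod => i /sJ iJ.
apply: measurable_funD => //; apply: measurable_funM => //.
by apply: measurable_indic; exact: mE.
Qed.

Lemma prod1D_indic_ge0 (tau : R) (s : seq I) (w : Omega) : 0 <= tau ->
  0 <= \prod_(i <- s) (1 + tau * \1_(E i) w).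
Proof.
move=> tau0; apply: prodr_ge0 => i _.
by rewrite addr_ge0// mulr_ge0// indicE.
Qed.

(* Generalizing the domain of integration to an intersection of further events
   makes the expansion of the product an induction on the list. *)
Lemma integral_prod1D_indic (tau : R) (s : seq I) (t : {fset I}) :
  0 <= tau -> uniq s -> {subset s <= J} -> {subset t <= J} ->
  (forall i, i \in s -> i \notin t) ->
  (\int[P]_(w in \bigcap_(i in [set` t]) E i)
      (\prod_(i <- s) (1 + tau * \1_(E i) w))%:E)%E =
  ((\prod_(i <- t) p i) * \prod_(i <- s) (1 + tau * p i))%:E.
Proof.
move=> tau0; elim: s t => [|j s IHs] t.
  move=> _ _ tJ _; rewrite big_nil mulr1.
  under eq_integral do rewrite big_nil.
  rewrite integral_cst ?mul1e; last first.
    by apply: fin_bigcap_measurable => // i /= /tJ /mE.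
  rewrite [LHS]indepE// -prodEFin big_seq [RHS]big_seq.
  by apply: eq_bigr => i /tJ /PE.
move=> /= /andP[js us] sJ tJ st.
have jJ : j \in J by apply: sJ; rewrite mem_head.
have sJ' : {subset s <= J} by move=> i si; apply: sJ; rewrite inE si orbT.
have jt : j \notin t by apply: st; rewrite mem_head.
have mt : measurable (\bigcap_(i in [set` t]) E i).
  by apply: fin_bigcap_measurable => // i /= /tJ /mE.
have IHt := IHs t us sJ' tJ
  (fun i si => st i (introT orP (or_intror si))).
have jtJ : {subset (j |` t)%fset <= J}.
  by move=> i /fset1UP[->//|]; exact: tJ.
have sjt i : i \in s -> i \notin (j |` t)%fset.
  move=> si; rewrite in_fset1U negb_or st ?inE ?si ?orbT// andbT.
  by apply: contraNneq js => <-.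
(* The factor of [j] splits the integral in two: the summand [1] leaves the domain as it is ([IHt]),
   while the indicator of [E j] shrinks it to the intersection over [j] added to [t] ([IHjt]). *)
have := IHs _ us sJ' jtJ sjt.
rewrite bigcap_fsetU1 setIC integral_mkcondr big_fsetU1//= => IHjt.
under eq_integral.
  move=> w _; rewrite big_cons mulrDl mul1r EFinD -mulrA EFinM.
  have -> : (\1_(E j) w * \prod_(i <- s) (1 + tau * \1_(E i) w))%:E =
    ((EFin \o (fun w => \prod_(i <- s) (1 + tau * \1_(E i) w) : R)) \_ (E j)) w
    :> \bar R.
    by rewrite patchE indicE; case: ifP; rewrite ?mul1r ?mul0r.
  over.
have mpatch : measurable_fun (\bigcap_(i in [set` t]) E i)
    ((EFin \o (fun w => \prod_(i <- s) (1 + tau * \1_(E i) w) : R)) \_ (E j)).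
  apply/(measurable_restrict _ _ _) => //; first exact: mE.
  exact: measurable_prod1D_indic.
have patch_ge0 w : (0 <=
    ((EFin \o (fun w => \prod_(i <- s)
      (1 + tau * \1_(E i) w) : R)%R) \_ (E j)) w)%E.
  by rewrite patchE; case: ifP => // _; rewrite lee_fin prod1D_indic_ge0.
rewrite ge0_integralD//; last 4 first.
- by move=> w _; rewrite lee_fin prod1D_indic_ge0.
- exact: measurable_prod1D_indic.
- by move=> w _; rewrite mule_ge0.
- exact: measurable_funeM.
rewrite ge0_integralZl_EFin// IHt IHjt -EFinM -EFinD big_cons.
by congr EFin; ring.
Qed.

(** Markov's inequality for [1 + tau] to the power of the number of events that occur. The base
    [1 + tau] is the optimal one for the threshold [(1 + tau) * M]. *)
Lemma chernoff_indep_events (tau M : R) :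
  0 <= tau <= 1 -> \sum_(i <- J) p i <= M ->
  (P [set w | ((1 + tau) * M <= \sum_(i <- J) \1_(E i) w)%R]
     <= (expR (- (tau ^+ 2 / 6) * M))%:E)%E.
Proof.
move=> tau01 pM; have /andP[tau0 tau1] := tau01.
set A := [set w | _].
have p0 i : i \in J -> 0 <= p i.
  by move=> iJ; rewrite -lee_fin -PE// measure_ge0.
have M0 : 0 <= M.
  by apply: le_trans pM; rewrite big_seq; apply: sumr_ge0 => i /p0.
have mA : measurable A.
  have mf : measurable_fun setT (fun w => \sum_(i <- J) \1_(E i) w : R).
    (* [E i] is known to be measurable only for [i] in [J], so the summands are set to zero
       elsewhere. *)
    have -> : (fun w => \sum_(i <- J) \1_(E i) w : R) =
        (fun w => \sum_(i <- J) (if i \in J then \1_(E i) w else 0)).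
      by apply/funext => w; apply: eq_big_seq => i ->.
    apply: measurable_sum => i; case: (boolP (i \in J)) => // iJ.
    by apply: measurable_indic; exact: mE.
  have -> : A = setT `&` (fun w => \sum_(i <- J) \1_(E i) w : R) @^-1`
      `[(1 + tau) * M, +oo[.
    by rewrite setTI; apply/seteqP; split => w /=; rewrite in_itv/= andbT.
  exact: mf.
have intE : (\int[P]_w (\prod_(i <- J) (1 + tau * \1_(E i) w))%:E =
    (\prod_(i <- J) (1 + tau * p i))%:E)%E.
  have := @integral_prod1D_indic tau J fset0 tau0 (fset_uniq J) (fun i => id).
  rewrite big_seq_fset0 mul1r bigcap_fset big_seq_fset0; apply => //.
(* [K] is the value of the product when the count equals the threshold; on [A] the product is at
   least [K]. *)
set K := expR ((1 + tau) * ln (1 + tau) * M).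
have prodE w : \prod_(i <- J) (1 + tau * \1_(E i) w) =
    expR (ln (1 + tau) * \sum_(i <- J) \1_(E i) w).
  rewrite mulr_sumr expR_sum; apply: eq_bigr => i _.
  rewrite indicE; case: (w \in E i); last by rewrite !mulr0 addr0 expR0.
  by rewrite !mulr1 lnK// posrE; lra.
have ln0 : 0 <= ln (1 + tau) by rewrite ln_ge0//; lra.
have KP : (K%:E * P A <= (\prod_(i <- J) (1 + tau * p i))%:E)%E.
  rewrite -intE -[in leLHS](setIT A) -integral_indic//.
  rewrite -ge0_integralZl_EFin//; last 2 first.
  - by apply/measurable_EFinP; exact: measurable_indic.
  - exact: expR_ge0.
  apply: ge0_le_integral => //.
  - by move=> w _; rewrite mule_ge0// lee_fin expR_ge0.
  - by apply: measurable_funeM; apply/measurable_EFinP; exact: measurable_indic.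
  - exact: measurable_prod1D_indic.
  move=> w _; rewrite -EFinM lee_fin indicE.
  have [|_] := boolP (w \in A); last by rewrite mulr0 prod1D_indic_ge0.
  rewrite inE /A/= => Aw; rewrite mulr1 prodE ler_expR.
  by rewrite [_ * ln _]mulrC -mulrA ler_wpM2l.
have prodp : \prod_(i <- J) (1 + tau * p i) <= expR (tau * M).
  apply: (@le_trans _ _ (expR (tau * \sum_(i <- J) p i))); last first.
    by rewrite ler_expR ler_wpM2l.
  rewrite mulr_sumr expR_sum big_seq [leRHS]big_seq; apply: ler_prod => i iJ.
  by rewrite expR_ge1Dx addr_ge0// mulr_ge0// p0.
have K0 : 0 < K by exact: expR_gt0.
rewrite -(@lee_pmul2l _ K%:E) ?lte_fin//; apply: (le_trans KP).
rewrite -EFinM lee_fin; apply: (le_trans prodp).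
rewrite /K -expRD ler_expR -mulrDl ler_wpM2r//.
(* The exponent left to bound is [tau - (1 + tau) * ln (1 + tau)], per unit of [M]. *)
by have := mul1Dx_ln1Dx_ge tau01; lra.
Qed.

End Chernoff.

(** * Estimates for the sample sizes and for the expected number of redraws *)

Section SampleSize.
Context {R : realType}.
Variable eps : R.
Hypothesis heps : 0 < eps < 1.

Let L (m : nat) : R := ln (2 * m%:R) - ln eps.

Lemma ln2_bounds : 1 / 2 <= ln (2 : R) < 1.
Proof.
apply/andP; split; first by apply: le_trans (@ln_ge1BV R 2 _) => //; lra.
rewrite -[ltRHS]expRK ltr_ln ?posrE ?expR_gt0//.
have -> : 2 = 1 + 1 :> R by lra.
exact: expR_gt1Dx.
Qed.

(** Together with [1 / 2 <= L m], this makes [c * L m] at least 2, which is what absorbs the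
    rounding error of the ceiling. *)
Lemma sampling_const_ge4 : 4 <= sampling_const R.
Proof.
have /andP[l1 l2] := ln2_bounds.
by rewrite /sampling_const ler_pdivlMr; lra.
Qed.

Lemma log_factor_ge (m : nat) : (0 < m)%N -> 1 / 2 <= L m.
Proof.
move=> m0; have /andP[e0 e1] := heps.
have /andP[l1 _] := ln2_bounds.
have lne : ln eps <= 0 by rewrite ln_le0// ltW.
have : ln 2 <= ln (2 * m%:R) :> R.
  by rewrite ler_ln ?posrE ?mulr_gt0 ?ltr0n// ler_peMr// ler1n.
rewrite /L; lra.
Qed.

Lemma log_factor_mono (k m : nat) : (0 < k)%N -> (k <= m)%N -> L k <= L m.
Proof.
move=> k0 km; rewrite /L lerD2r ler_ln ?posrE ?mulr_gt0 ?ltr0n//.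
  by rewrite ler_wpM2l// ler_nat.
exact: leq_trans km.
Qed.

Lemma sample_size_bounds (m : nat) : (0 < m)%N ->
  sampling_const R * m%:R * L m <= (sample_size eps m)%:R
    <= sampling_const R * m%:R * L m + 1.
Proof.
move=> m0; rewrite /sample_size gtn_eqF//= -/(L m).
have c4 := sampling_const_ge4; have L0 := log_factor_ge m0.
have r0 : 0 <= sampling_const R * m%:R * L m.
  by apply: mulr_ge0; [apply: mulr_ge0 => //; lra|lra].
rewrite natr_absz ger0_norm; last by rewrite ceil_ge0; lra.
rewrite ceil_ge/=.
have := ceilB1_lt (sampling_const R * m%:R * L m).
by rewrite intrD; lra.
Qed.

Lemma sample_size_ndecr (m : nat) :
  (sample_size eps m <= sample_size eps m.+1)%N.
Proof.
case: m => [|m]; first by rewrite {1}/sample_size.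
have c4 := sampling_const_ge4.
have Lm := @log_factor_ge m.+1 isT.
have Lmono := @log_factor_mono m.+1 m.+2 isT (leqnSn _).
have r0 : 0 <= sampling_const R * m.+1%:R * L m.+1.
  by apply: mulr_ge0; [apply: mulr_ge0 => //; lra|lra].
have r_le : sampling_const R * m.+1%:R * L m.+1 <=
    sampling_const R * m.+2%:R * L m.+2.
  have c0 : 0 <= sampling_const R by lra.
  apply: ler_pM => //; [exact: mulr_ge0|lra|].
  by rewrite ler_wpM2l// ler_nat.
(* The ceiling is nonnegative as soon as its argument exceeds -1, hence the comparisons with -1
   below. *)
rewrite -(ler_nat R) /sample_size/= !natr_absz !ger0_norm ?ceil_ge0.
- by rewrite ler_int; exact: le_ceil.
- exact: lt_le_trans (ltrN10 R) (le_trans r0 r_le).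
- exact: lt_le_trans (ltrN10 R) r0.
Qed.

(** Passing from [k] to [k + 1] in [c * k * L k] adds [c * L k], which covers the [1] lost to
    rounding up. *)
Lemma sample_size_div_le (k : nat) : (0 < k)%N ->
  (sample_size eps k)%:R / k.+1%:R <= sampling_const R * L k.
Proof.
move=> k0; have /andP[_ nk] := sample_size_bounds k0.
have c4 := sampling_const_ge4; have L0 := log_factor_ge k0.
rewrite ler_pdivrMr ?ltr0n// (le_trans nk)//.
rewrite -natr1; nra.
Qed.

(** Each of the [m] terms is at most [c * L m], and [c * m * L m] is the sample size before rounding
    up. *)
Lemma sum_sample_size_div_le (m : nat) :
  \sum_(1 <= k < m.+1) (sample_size eps k)%:R / k.+1%:R
    <= (sample_size eps m)%:R :> R.
Proof.
case: m => [|m]; first by rewrite big_geq.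
have /andP[+ _] := @sample_size_bounds m.+1 isT; apply: le_trans.
have c4 := sampling_const_ge4.
apply: (@le_trans _ _ (\sum_(1 <= k < m.+2) sampling_const R * L m.+1)).
  rewrite big_nat [leRHS]big_nat; apply: ler_sum => k /andP[k0 km].
  apply: (le_trans (sample_size_div_le k0)).
  by rewrite ler_wpM2l ?log_factor_mono//; lra.
by rewrite sumr_const_nat subn1 /= [leRHS]mulrAC mulr_natr.
Qed.

End SampleSize.

(** * Tail of the cost, by reduction to independent label events *)

Theorem theorem3p4 (R : realType) (d : nat) (D : set 'rV[R]_d)
    (rho : probability (borel_rV R d) R) (phi : nat -> borel_rV R d -> R)
    (dO : measure_display) (Omega : measurableType dO)
    (P : probability Omega R) (eps : R)
    (a : nat -> nat -> Omega -> nat)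
    (x S : nat -> nat -> Omega -> borel_rV R d)
    (hD : is_domain D) (hrho : rho D = 1%E)
    (hphi : orthonormal_sequence D rho phi)
    (heps : 0 < eps < 1)
    (hS : sequential_sampling D rho phi (sample_size eps) P a x S)
    (m : nat) (hm : (1 <= m)%N) (tau : R) (htau : 0 <= tau <= 1) :
  let n := sample_size eps in
  let c := sampling_const R in
  (P [set w | ((n m)%:R + (1 + tau) * ((n m.-1)%:R + 1)
                <= (cost n a m w)%:R :> R)%R]
     <= (tail_const tau * expR (- (tau ^+ 2 / 6) * (n m.-1)%:R))%:E)%E
  /\
  tail_const tau * expR (- (tau ^+ 2 / 6) * (n m.-1)%:R)
    <= tail_const tau *
       (2 * (m.-1)%:R / eps) `^ (- (tau ^+ 2 * c / 6) * (m.-1)%:R).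
Proof.
move=> n c; have /andP[e0 e1] := heps; have /andP[t0 t1] := htau.
have c4 : 4 <= c := sampling_const_ge4.
have M1 : 1 <= tail_const tau.
  rewrite -expR0 ler_expR divr_ge0// mulr_ge0 ?sqr_ge0// mulr_ge0//.
  exact: le_trans c4.
have t6 : 0 <= tau ^+ 2 / 6 by rewrite divr_ge0// sqr_ge0.
split; last first.
  rewrite ler_wpM2l ?(le_trans ler01)//.
  (* For [m = 1] both exponentials equal 1: [n 0] is 0, and a power with exponent 0 is 1 even at
     base 0, in accordance with the convention for this case. *)
  case: m hm => // -[_|m _]; first by rewrite !mulr0 powRr0 expR0.
  rewrite /= /powR gt_eqF ?ler_expR; last by rewrite divr_gt0// mulr_gt0 ?ltr0n.
  rewrite ln_div ?posrE ?mulr_gt0 ?ltr0n//.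
  (* Once the power is written as an exponential, the claim is the lower bound on the ceiling,
     scaled by [tau ^+ 2 / 6]. *)
  have /andP[+ _] := sample_size_bounds heps (ltn0Sn m).
  move=> /(ler_wpM2l t6); rewrite -/n -/c; lra.
pose s := [seq (k, i) | k <- index_iota 1 m, i <- index_iota 0 (n k)].
(* The shift is due to labels being indexed by the level they lead to: position [i] of level [k] is
   redrawn according to [a k.+1 i]. *)
pose f (v : nat * nat) : nat * nat + nat * nat := inl (v.1.+1, v.2).
have f_inj : injective f by move=> [k i] [k' i'] [-> ->].
have us : uniq (map f s).
  rewrite map_inj_uniq//; apply: allpairs_uniq_dep; rewrite ?iota_uniq//.
    by move=> k _; exact: iota_uniq.
  by move=> [k i] [k' i'] _ _ /= [-> ->].
pose J : {fset nat * nat + nat * nat} := [fset v in map f s]%fset.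
(* A redraw happens when the label takes its top value [k], with probability [1 / k]. [J] contains
   labels only; [setT] and [1] are default values at the points. *)
pose E (v : nat * nat + nat * nat) : set Omega :=
  if v is inl (k, i) then a k i @^-1` [set k] else setT.
pose p (v : nat * nat + nat * nat) : R :=
  if v is inl (k, i) then k%:R^-1 else 1.
have sumJ (F : nat * nat + nat * nat -> R) : \sum_(v <- J) F v =
    \sum_(1 <= k < m) \sum_(0 <= i < n k) F (inl (k.+1, i)).
  rewrite (perm_big (map f s)) ?big_map ?big_allpairs_dep//.
  by apply: uniq_perm => //; [exact: fset_uniq|move=> v; rewrite inE].
have JP v : v \in J ->
    exists k i, [/\ v = inl (k.+1, i), (0 < k)%N & (i < n k)%N].
  rewrite !inE => /mapP[_ /allpairsPdep[k [i [+ + ->]]] ->].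
  rewrite !mem_index_iota => /andP[k0 _] /andP[_ ik].
  by exists k, i.
have drawE v : v \in J -> random_draws n v /\ draw_events a x v (E v).
  move=> /JP[k [i [-> k0 ik]]]; split; first exact/andP.
  by exists [set k.+1] => //; rewrite setTI.
have mE v : v \in J -> measurable (E v).
  move=> /JP[k [i [-> k0 ik]]]; rewrite -[E _]setTI.
  by apply: (label_measurable hS) => //; exact/andP.
have PE v : v \in J -> P (E v) = (p v)%:E.
  move=> /JP[k [i [-> k0 ik]]].
  by apply: (label_uniform hS); rewrite ?leqnn//; exact/andP.
have indE (t : {fset nat * nat + nat * nat}) : {subset t <= J} ->
    P (\bigcap_(i in [set` t]) E i) = (\prod_(i <- t) P (E i))%E.
  by move=> tJ; apply: (draws_independent hS) => v /tJ /drawE[].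
(* The mean is even at most [n m.-1]; the added [1] matches the threshold of the theorem. *)
have sump : \sum_(v <- J) p v <= (n m.-1)%:R + 1.
  rewrite sumJ; apply: le_trans (_ : (n m.-1)%:R <= _); last by rewrite lerDl.
  have := sum_sample_size_div_le heps m.-1; rewrite prednK//; apply: le_trans.
  apply: ler_sum => k _.
  by rewrite sumr_const_nat subn0 mulr_natl.
have := chernoff_indep_events mE PE indE htau sump.
(* By [cost_explicit], the cost exceeds [n m] by exactly the number of events of [J] that occur. *)
have -> : [set w | ((1 + tau) * ((n m.-1)%:R + 1)
                      <= \sum_(v <- J) \1_(E v) w)%R]
    = [set w | ((n m)%:R + (1 + tau) * ((n m.-1)%:R + 1)
                <= (cost n a m w)%:R :> R)%R].
  apply: eq_set => w; rewrite cost_explicit//; last exact: sample_size_ndecr.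
  rewrite natrD lerD2l sumJ natr_sum; congr (is_true (_ <= _)).
  apply: eq_bigr => k _; rewrite natr_sum; apply: eq_bigr => i _.
  by rewrite indicE; congr ((nat_of_bool _)%:R); apply/idP/eqP; rewrite inE.
(* The exponent obtained has [n m.-1 + 1] where the claim has [n m.-1], and the factor
   [tail_const tau] is at least 1, so both changes enlarge the bound. *)
move=> /le_trans; apply; rewrite lee_fin -[leLHS]mul1r.
apply: ler_pM => //.
by rewrite ler_expR; lra.
Qed.
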